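(* Let $d\ge1$ be fixed, let $n$ be sufficiently large, and let $S$ be the binary sequence of Construction 1A described in the context. Suppose $w\in\{0,1\}^n$ is a corrupted subword of $S$ with exactly $e$ errors, i.e. the Hamming distance between $w$ and $S[i,i+n-1]$ equals $e$ for some position $i$ with $0\le i\le Mn-n$. If $2e<d$, then the locating algorithm described in the context, applied to $w$, determines (outputs) the position $i$ of $w$ in $S$, and it runs in $O(n^3)$ time.
   Context: Notation: $\log=\log_2$; $[a,b]=\{a,\dots,b\}$; for a word $x$, $x[i,j]$ is the contiguous subword from index $i$ to index $j$ (indices start at $0$, read cyclically inside a word when needed); $x^t$ is the concatenation of $t$ copies of $x$; $d_H$ is Hamming distance and $w_H$ Hamming weight. Parameters ($d$ fixed, $n$ large; all parameters are assumed to be integers): $\ell=d\lceil\log d\rceil+2d$; $u=1^d u_0u_1\cdots u_{\lceil\log d\rceil}\in\{0,1\}^\ell$ where $u_i=((1^{2^i}0^{2^i})^d)[0,d-1]$; $m=\frac32\log n$; $k=3m$; $\ell_p=k+\ell$; $p=0^ku$ (of length $\ell_p$); $n'=n-\ell_p$; $q=2^m$; $n_R=(n'-(2d+2)d)/m$; $k_R=n_R-2d-2$; $\phi:\mathbb F_q\to\mathbb F_2^m$ an arbitrary bijection; $X=\{\alpha\in\mathbb F_q: w_H(\phi(\alpha))\ge d\}$; $r=|X|=\sum_{i=d}^m\binom mi$; $M=r^{k_R}$. Gray code: $(\sigma_0,\dots,\sigma_{M-1})$ is a listing of all vectors of $X^{k_R}$ in which consecutive vectors differ in exactly one coordinate,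 chosen so that the map $\mathrm{dec}_{\rm Gray}:\sigma_i\mapsto i$ is computable in $O(k_R\log^2 q)$ time. Reed–Solomon code: evaluations of all polynomials over $\mathbb F_q$ of degree $<k_R$ at $n_R$ distinct points of $\mathbb F_q$, with systematic encoder $\mathrm{enc}$ (the first $k_R$ symbols of $\mathrm{enc}(\sigma)$ are $\sigma$). Keeping only some $n_0\geq k_R$ of the coordinates, including the first $k_R$, gives a Reed–Solomon code of length $n_0$ and dimension $k_R$; $\mathrm{dec}^{(n_0,k_R)}$ denotes a decoder, running in $O(n^3)$ time, that returns the codeword $c$ of that code whenever its input is within Hamming distance $(n_0-k_R)/2$ of $c$. Construction 1A: $c_i=\mathrm{enc}(\sigma_i)$, $$s_i=\phi(c_i[0])\cdots\phi(c_i[k_R-1])\,1^d\phi(c_i[k_R])\,1^d\phi(c_i[k_R+1])\cdots1^d\phi(c_i[n_R-1])\in\{0,1\}^{n'},$$ for $0\le i\le M-1$, and $S=p\,s_0\,p\,s_1\cdots p\,s_{M-1}$ (of length $Mn$). Locating algorithm on input $w\in\{0,1\}^n$: (1) Let $\hat i\in[0,n-1]$ be the unique index such that the cyclic subword $w[\hat i,\hat i+\ell_p-1]$ satisfies $d_H(w[\hat i,\hat i+\ell_p-1],p)\le(d-1)/2$; let $\bar i\in[0,n-1]$ with $\bar i+\hat i\equiv0\pmod n$. (2) Let $v$ be $w$ rotated cyclically leftwards by $\hat i$ positions; let $\hat v$ be obtained from $v$ by deleting $v[0,\ell_p-1]$ and deleting $v[\ell_p+mk_R+(m+d)j,\ \ell_p+mk_R+(m+d)j+d-1]$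 for all $0\le j\le n_R-k_R-1$; let $\bar c=\phi^{-1}(\hat v[0,m-1])\phi^{-1}(\hat v[m,2m-1])\cdots\phi^{-1}(\hat v[m(n_R-1),mn_R-1])\in\mathbb F_q^{n_R}$. (3) If $\bar i\in[0,\ell_p+mk_R-1]$: $c=\mathrm{dec}^{(n_R,k_R)}(\bar c)$ and $a=\mathrm{dec}_{\rm Gray}(c[0,k_R-1])$. If $\bar i\in[\ell_p+mk_R,\ell_p+mk_R+(d+1)(m+d)-1]$: put $\bar c^s=\bar c[0,k_R-1]\,\bar c[k_R+d+1,n_R-1]$, $c^s=\mathrm{dec}^{(n_R-(d+1),k_R)}(\bar c^s)$ and $a=\mathrm{dec}_{\rm Gray}(c^s[0,k_R-1])$. Otherwise: put $\bar c^s=\bar c[0,k_R+d]$, $c^s=\mathrm{dec}^{(n_R-(d+1),k_R)}(\bar c^s)$ and define $a$ by $a+1=\mathrm{dec}_{\rm Gray}(c^s[0,k_R-1])$. (4) Output $an+\bar i$. *)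

(* Defs.v *)
From mathcomp Require Import all_boot all_order all_algebra.

Set Implicit Arguments.
Unset Strict Implicit.
Unset Printing Implicit Defensive.

Local Open Scope nat_scope.

(** * Words *)

Definition hamming_dist (T : eqType) (x y : seq T) : nat :=
  count (fun ab => ab.1 != ab.2) (zip x y).

Definition hamming_weight (x : seq bool) : nat := count id x.

(* x[i, j], both ends included *)
Definition subword (T : Type) (x : seq T) (i j : nat) : seq T :=
  take (j.+1 - i) (drop i x).

Definition wpow (T : Type) (x : seq T) (t : nat) : seq T := flatten (nseq t x).

(** * Parameters *)

Definition ceil_log (d : nat) : nat := up_log 2 d.

Definition ell (d : nat) : nat := d * ceil_log d + 2 * d.

Definition u_block (d i : nat) : seq bool :=
  subword (wpow (nseq (2 ^ i) true ++ nseq (2 ^ i) false) d) 0 (d - 1).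

Definition u_word (d : nat) : seq bool :=
  nseq d true ++ flatten [seq u_block d i | i <- iota 0 (ceil_log d).+1].

(* m = (3/2) log n, rounded up to an integer: the least m with n^3 <= 2^(2m).
   When (3/2) log n is an integer it is exactly that integer. *)
Definition m_par (n : nat) : nat := up_log 4 (n ^ 3).

Definition k_par (n : nat) : nat := 3 * m_par n.

Definition ell_p (d n : nat) : nat := k_par n + ell d.

Definition p_word (d n : nat) : seq bool := nseq (k_par n) false ++ u_word d.

Definition n' (d n : nat) : nat := n - ell_p d n.

Definition integral_params (d n : nat) : bool :=
  m_par n %| n' d n - (2 * d + 2) * d.

Definition n_R (d n : nat) : nat := (n' d n - (2 * d + 2) * d) %/ m_par n.

Definition k_R (d n : nat) : nat := n_R d n - 2 * d - 2.

(** * Construction 1A *)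

Definition RS_code (F : fieldType) (k : nat) (points : seq F) (c : seq F) : Prop :=
  exists2 f : {poly F}, size f <= k & c = [seq f.[x]%R | x <- points].

Record construction1A (d n : nat) := Construction1A {
  Fq : finFieldType;
  card_Fq : #|Fq| = 2 ^ m_par n;
  phi : Fq -> (m_par n).-tuple bool;
  phi_inv : (m_par n).-tuple bool -> Fq;
  phiK : cancel phi phi_inv;
  phi_invK : cancel phi_inv phi;
  Xset := [set alpha : Fq | d <= hamming_weight (phi alpha)];
  Mpar := #|Xset| ^ k_R d n;
  gray : seq ((k_R d n).-tuple Fq);
  gray_size : size gray = Mpar;
  gray_mem : forall x : (k_R d n).-tuple Fq,
    (x \in gray) = all (fun alpha => alpha \in Xset) x;
  gray_step : sorted (fun x y : (k_R d n).-tuple Fq => hamming_dist x y == 1) gray;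
  points : (n_R d n).-tuple Fq;
  points_uniq : uniq points;
  enc : (k_R d n).-tuple Fq -> (n_R d n).-tuple Fq;
  enc_code : forall x, RS_code (k_R d n) points (enc x);
  enc_systematic : forall x, take (k_R d n) (enc x) = x
}.

Section Sequence.
Variables (d n : nat) (K : construction1A d n).

Definition s_word (c : seq (Fq K)) : seq bool :=
  flatten [seq val (phi x) | x <- take (k_R d n) c]
  ++ flatten [seq nseq d true ++ val (phi x) | x <- drop (k_R d n) c].

Definition S_word : seq bool :=
  flatten [seq p_word d n ++ s_word (enc x) | x <- gray K].

End Sequence.

(** * Running time *)

(* A value together with the number of bit operations spent to obtain it.
   The machine is a random access machine with logarithmic cost: arithmetic
   pays schoolbook prices in the bit lengths of its operands, a memory access
   pays for the bits of the address and of the cell, and advancing a loop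
   counter pays for an increment and a comparison with the bound.  The numbers
   depending only on d and n (m, n_R, ...) and the word p are constants of the
   program. *)
Record timed (A : Type) := Timed { result : A; time : nat }.

Definition ret (A : Type) (a : A) : timed A := Timed a 0.

Definition charge (t : nat) : timed unit := Timed tt t.

Definition bind (A B : Type) (x : timed A) (f : A -> timed B) : timed B :=
  let y := f (result x) in Timed (result y) (time x + time y).

Declare Scope timed_scope.
Delimit Scope timed_scope with T.
Bind Scope timed_scope with timed.

Notation "'let!' x := e 'in' f" := (bind e (fun x => f))
  (at level 200, x name, e at level 100, f at level 200) : timed_scope.

Definition nat_timed (x : nat) : timed nat := ret x.
Coercion nat_timed : nat >-> timed.

Definition op2 (A B C : Type) (f : A -> B -> C) (cost : A -> B -> nat)
    (x : timed A) (y : timed B) : timed C :=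
  bind x (fun a => bind y (fun b => Timed (f a b) (cost a b))).

Definition bits (x : nat) : nat := (trunc_log 2 x).+1.

Definition linear_cost (x y : nat) : nat := bits x + bits y.
Definition product_cost (x y : nat) : nat := bits x * bits y.

Notation "x + y" := (op2 addn linear_cost x%T y%T) : timed_scope.
Notation "x - y" := (op2 subn linear_cost x%T y%T) : timed_scope.
Notation "x * y" := (op2 muln product_cost x%T y%T) : timed_scope.
Notation "x %% y" := (op2 modn product_cost x%T y%T) : timed_scope.
Notation "x <= y" := (op2 leq linear_cost x%T y%T) : timed_scope.
Notation "x < y" := (op2 ltn linear_cost x%T y%T) : timed_scope.
Notation "x == y" := (op2 (@eq_op bool) (fun _ _ => 1) x%T y%T) : timed_scope.
Notation "x && y" := (op2 andb (fun _ _ => 1) x%T y%T) : timed_scope.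
Notation "x || y" := (op2 orb (fun _ _ => 1) x%T y%T) : timed_scope.

(* In get and push, c is the number of bits of a memory cell of the array. *)
Definition get (A : Type) (x0 : A) (c : nat) (s : seq A) (j : timed nat) : timed A :=
  bind j (fun i => Timed (nth x0 s i) (bits i + c)).

Definition push (A : Type) (c : nat) (s : seq A) (x : A) : timed (seq A) :=
  Timed (rcons s x) (bits (size s) + c).

Fixpoint loop_from (A : Type) (j k : nat) (body : nat -> A -> timed A) (a : A) : timed A :=
  if k is k'.+1 then
    (let! b := body j a in
     let! _ := charge (linear_cost j (j + k)%N) in
     loop_from j.+1 k' body b)%T
  else ret a.

(* for j = 0, ..., k - 1 do a := body j a *)
Definition loop (A : Type) (k : nat) (body : nat -> A -> timed A) (a : A) : timed A :=
  loop_from 0 k body a.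

(* appends x[i, i + len - 1] to acc *)
Definition copy (A : Type) (x0 : A) (c : nat) (x : seq A) (i len : nat) (acc : seq A) :
    timed (seq A) :=
  loop len (fun j acc => let! a := get x0 c x (i + j) in push c acc a)%T acc.

(** * Decoders *)

Section Decoders.
Variables (d n : nat) (K : construction1A d n).

(* dec^(n_0, k_R) depends on the set J of the n_0 coordinates that are kept. *)
Definition RS_decoder := {set 'I_(n_R d n)} -> seq (Fq K) -> timed (seq (Fq K)).

Definition RS_decoder_spec (C : nat) (dec : RS_decoder) : Prop :=
  forall J : {set 'I_(n_R d n)},
    k_R d n <= #|J| -> (forall i : 'I_(n_R d n), i < k_R d n -> i \in J) ->
  forall y : seq (Fq K), size y = #|J| ->
    time (dec J y) <= C * n ^ 3 /\
    (forall c : seq (Fq K),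
        RS_code (k_R d n) [seq tnth (points K) i | i in J] c ->
        2 * hamming_dist y c <= #|J| - k_R d n ->
        result (dec J y) = c).

Definition Gray_decoder := seq (Fq K) -> timed nat.

(* log q = m *)
Definition Gray_decoder_spec (C : nat) (decG : Gray_decoder) : Prop :=
  forall (i : nat) (x0 : (k_R d n).-tuple (Fq K)), i < Mpar K ->
    result (decG (nth x0 (gray K) i)) = i /\
    time (decG (nth x0 (gray K) i)) <= C * (k_R d n * m_par n ^ 2).

End Decoders.

(** * The locating algorithm *)

Section Locating.
Variables (d n : nat) (K : construction1A d n).
Variables (dec : RS_decoder K) (decG : Gray_decoder K).

Local Notation m := (m_par n).
Local Notation lp := (ell_p d n).
Local Notation nR := (n_R d n).
Local Notation kR := (k_R d n).
Local Notation getb := (get false 1).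
Local Notation gets := (get 0%R m).

(* d_H(w[i, i + ell_p - 1], p), with w read cyclically *)
Definition window_dist (w : seq bool) (i : nat) : timed nat :=
  (loop lp (fun j (h : nat) =>
     let! same := getb w ((i + j) %% n) == getb (p_word d n) j in
     if same then ret h else h + 1) 0)%T.

Definition candidates (w : seq bool) : timed (seq nat) :=
  (loop n (fun i acc =>
     let! h := window_dist w i in
     let! close := 2 * h <= d - 1 in
     if close then push (bits n) acc i else ret acc) [::])%T.

Definition rotate (w : seq bool) (ihat : nat) : timed (seq bool) :=
  (loop n (fun j acc =>
     let! b := getb w ((ihat + j) %% n) in push 1 acc b) [::])%T.

Definition deleted (j : nat) : timed bool :=
  (let! in_p := j < lp in
   if in_p then ret true else
   loop (nR - kR)%N (fun j' found =>
     let! start := lp + m * kR + (m + d) * j' in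
     ret found || ((start <= j) && (j <= start + d - 1))) false)%T.

Definition delete_markers (v : seq bool) : timed (seq bool) :=
  (loop n (fun j acc =>
     let! del := deleted j in
     if del then ret acc else let! b := getb v j in push 1 acc b) [::])%T.

(* phi is arbitrary, so its inverse is a table indexed by m-bit addresses
   whose entries are m-bit symbols. *)
Definition lookup_phi_inv (b : seq bool) : timed (Fq K) :=
  Timed (phi_inv K [tuple nth false b t | t < m]) (m + m)%N.

Definition read_symbols (vhat : seq bool) : timed (seq (Fq K)) :=
  (loop nR (fun j acc =>
     let! start := m * j in
     let! b := copy false 1 vhat start m [::] in
     let! a := lookup_phi_inv b in
     push m acc a) [::])%T.

Definition all_coords : {set 'I_nR} := setT.
Definition outer_coords : {set 'I_nR} := [set i : 'I_nR | (i < kR) || (kR + d + 1 <= i)].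
Definition inner_coords : {set 'I_nR} := [set i : 'I_nR | i <= kR + d].

Definition gray_index (c : seq (Fq K)) : timed nat :=
  (let! x := copy 0%R m c 0 kR [::] in decG x)%T.

Definition find_block (cbar : seq (Fq K)) (ibar : nat) : timed nat :=
  (let! case1 := ibar <= lp + m * kR - 1 in
   if case1 then
     let! c := dec all_coords cbar in
     gray_index c
   else
   let! case2 := ibar <= lp + m * kR + (d + 1) * (m + d) - 1 in
   if case2 then
     let! info := copy 0%R m cbar 0 kR [::] in
     let! cs := copy 0%R m cbar (kR + d + 1)%N (nR - (kR + d + 1))%N info in
     let! c := dec outer_coords cs in
     gray_index c
   else
     let! cs := copy 0%R m cbar 0 (kR + d + 1)%N [::] in
     let! c := dec inner_coords cs in
     gray_index c - 1)%T.

(* None when the index ihat of the first step does not exist or is not unique *)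
Definition locate (w : seq bool) : timed (option nat) :=
  (let! l := candidates w in
   let! _ := charge 1 in
   if l is [:: ihat] then
     let! ibar := (n - ihat) %% n in
     let! v := rotate w ihat in
     let! vhat := delete_markers v in
     let! cbar := read_symbols vhat in
     let! a := find_block cbar ibar in
     let! i := a * n + ibar in
     ret (Some i)
   else ret None)%T.

End Locating.

(* Main.v *)
(* A window of S starting at position a n + b is, up to a rotation by b, a word p s whose
   first b bits come from the block a + 1 and whose other bits come from the block a.
   Uniqueness of the marker: every other cyclic window of length l_p is at distance at
   least d from p.  Indeed, when the shift is large, 0^k faces a complete field 1^d or a
   complete phi(X)-symbol, or the field 1^d of u faces zeros; otherwise 1^d and 0^k overlap
   in |t| wrong positions and, with 2^i the largest power of 2 dividing the shift t, the
   field u_i is compared with its own complement in the other d - |t| positions.  Fewer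
   than d / 2 errors cannot change this.
   Decoding: the information parts of the blocks a and a + 1 differ in one symbol by the
   Gray property, and the coordinates kept in each case of the third step have all their
   redundancy taken from a single block, so at most e + 1 (in the last case e) symbols are
   wrong.
   Running time: since (log n)^2 = O(n), one operation costs O(n), and the loops perform
   O(n^2) of them. *)

Require Import Defs.
From mathcomp Require Import all_boot all_order all_algebra zify.

Set Implicit Arguments.
Unset Strict Implicit.
Unset Printing Implicit Defensive.

Local Open Scope nat_scope.

(** * Words and sums *)

Lemma hamming_distE (T : eqType) (x0 : T) (N : nat) (x y : seq T) :
  size x = N -> size y = N ->
  hamming_dist x y = \sum_(0 <= j < N) (nth x0 x j != nth x0 y j).
Proof.
rewrite /hamming_dist; elim: N x y => [|N IHN] [|a x] [|b y] //=; first by rewrite big_geq.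
by move=> [sx] [sy]; rewrite big_nat_recl //= -IHN.
Qed.

Lemma hamming_dist_map (T : eqType) (I : Type) (s : seq I) (f g : I -> T) :
  hamming_dist [seq f i | i <- s] [seq g i | i <- s] = \sum_(i <- s) (f i != g i).
Proof.
rewrite /hamming_dist zip_map count_map -sum1_count big_mkcond.
by apply: eq_bigr => i _ /=; case: (_ != _).
Qed.

Lemma sum_shift (F : nat -> nat) (x len : nat) :
  \sum_(x <= j < x + len) F j = \sum_(0 <= j < len) F (x + j).
Proof. by rewrite -{1}(add0n x) big_addn addKn; apply: eq_bigr => i _; rewrite addnC. Qed.

Lemma leq_sum_subrange (F : nat -> nat) (x len N : nat) :
  x + len <= N -> \sum_(0 <= j < len) F (x + j) <= \sum_(0 <= j < N) F j.
Proof.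
move=> le_N; rewrite -sum_shift (@big_cat_nat _ _ _ (x + len) 0 N) //=.
by rewrite (@big_cat_nat _ _ _ x 0 (x + len)) ?leq_addr //=; lia.
Qed.

(** Serves to collect mismatches from two disjoint fields of the marker when neither field alone
    yields [d] of them. *)
Lemma leq_sum_subranges (F : nat -> nat) (x len y len' N : nat) :
    x + len <= y -> y + len' <= N ->
  \sum_(0 <= j < len) F (x + j) + \sum_(0 <= j < len') F (y + j)
    <= \sum_(0 <= j < N) F j.
Proof.
move=> le_y le_N; rewrite (@big_cat_nat _ _ _ y 0 N) //=; last by lia.
apply: leq_add; first exact: leq_sum_subrange.
by rewrite -sum_shift (@big_cat_nat _ _ _ (y + len') y N) ?leq_addr.
Qed.

Lemma sum_true (F : nat -> bool) (len : nat) :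
  (forall j, j < len -> F j) -> \sum_(0 <= j < len) F j = len.
Proof.
move=> FT; rewrite (@eq_big_nat _ _ _ _ _ _ (fun=> 1)); last by move=> j /andP[_ /FT ->].
by rewrite sum_nat_const_nat subn0 muln1.
Qed.

Lemma hamming_weightE (y : seq bool) :
  hamming_weight y = \sum_(0 <= r < size y) nth false y r.
Proof.
rewrite /hamming_weight -sum1_count big_mkcond (big_nth false).
by apply: eq_bigr => r _; case: nth.
Qed.

Lemma iota_blocks (x c N : nat) :
  iota x (c * N) = flatten [seq iota (x + c * j) c | j <- iota 0 N].
Proof.
elim: N => [|N IHN]; first by rewrite muln0.
rewrite mulnSr iotaD IHN -[N.+1]addn1 iotaD map_cat flatten_cat /= cats0 add0n //.
Qed.

Lemma filter_pred0_in (T : eqType) (a : pred T) (s : seq T) :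
  {in s, forall y, ~~ a y} -> [seq y <- s | a y] = [::].
Proof. by move=> aN; apply/eqP; rewrite -(negbK (_ == _)) -has_filter; apply/hasPn. Qed.

Section FlattenBlocks.
Variables (T A : Type) (f : A -> seq T) (c : nat).
Hypothesis size_f : forall a, size (f a) = c.

Lemma size_flatten_blocks s : size (flatten [seq f a | a <- s]) = size s * c.
Proof. by elim: s => //= a s IHs; rewrite size_cat IHs size_f mulSn. Qed.

Lemma nth_flatten_blocks x0 a0 s q r : q < size s -> r < c ->
  nth x0 (flatten [seq f a | a <- s]) (q * c + r) = nth x0 (f (nth a0 s q)) r.
Proof.
move=> + lt_r; elim: s q => //= a s IHs [|q] lt_q; rewrite nth_cat size_f.
  by rewrite mul0n lt_r.
by rewrite ifF; [rewrite mulSn -addnA addKn IHs | lia].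
Qed.

End FlattenBlocks.

(** * The word u *)

Section Marker.
Variable d : nat.
Hypothesis d_gt0 : 0 < d.

Lemma size_wpow (T : Type) (x : seq T) t : size (wpow x t) = t * size x.
Proof. by rewrite size_flatten /shape map_nseq sumn_nseq mulnC. Qed.

Lemma size_u_block i : size (u_block d i) = d.
Proof.
rewrite /u_block /subword drop0 subn0 subn1 prednK // size_takel //.
by rewrite size_wpow size_cat !size_nseq; have := expn_gt0 2 i; nia.
Qed.

Lemma nth_u_block i j : j < d -> nth false (u_block d i) j = ~~ odd (j %/ 2 ^ i).
Proof.
move=> lt_j; rewrite /u_block /subword drop0 subn0 subn1 prednK // nth_take //.
have c_gt0 : 0 < 2 ^ i by rewrite expn_gt0.
set c := 2 ^ i in c_gt0 *; set x := nseq _ _ ++ _.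
have -> : wpow x d = flatten [seq x | _ <- nseq d tt] by rewrite /wpow map_nseq.
rewrite {1}(divn_eq j (c + c)).
have lt_r : j %% (c + c) < c + c by rewrite ltn_mod; lia.
rewrite (@nth_flatten_blocks _ _ (fun=> x) (c + c) _ _ tt) //; first last.
(* The index of the period containing [j] is at most [j < d], so [d] repetitions reach [j]. *)
- by rewrite size_nseq; apply: leq_ltn_trans lt_j; apply: leq_div.
- by rewrite size_cat !size_nseq.
rewrite {2}(divn_eq j (c + c)) mulnDr -mulnDl divnMDl //.
rewrite oddD [odd (_ + _)]oddD addbb addFb.
rewrite nth_cat size_nseq; set r := _ %% _ in lt_r *.
have [lt_rc | le_cr] := ltnP r c.
  by rewrite nth_nseq lt_rc divn_small.
have -> : r = 1 * c + (r - c) by lia.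
rewrite divnMDl // divn_small; last by lia.
by rewrite nth_nseq if_same.
Qed.

Lemma size_u_word : size (u_word d) = ell d.
Proof.
by rewrite /u_word /ell size_cat size_nseq (size_flatten_blocks size_u_block) size_iota; lia.
Qed.

Lemma nth_u_word_ones j : j < d -> nth false (u_word d) j.
Proof. by move=> lt_j; rewrite nth_cat size_nseq lt_j nth_nseq lt_j. Qed.

Lemma nth_u_word_block i j : i <= ceil_log d -> j < d ->
  nth false (u_word d) (d + i * d + j) = ~~ odd (j %/ 2 ^ i).
Proof.
move=> le_i lt_j; rewrite nth_cat size_nseq ifF; last by lia.
rewrite -addnA addKn (nth_flatten_blocks size_u_block _ 0) // ?size_iota //.
by rewrite nth_iota // nth_u_block.
Qed.

(* With t = 2^i o, o odd, a shift by t exchanges the two halves of the period of u_i. *)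
Lemma u_block_shift t : 0 < t < d ->
  exists2 i, i <= ceil_log d & forall j, odd ((j + t) %/ 2 ^ i) = ~~ odd (j %/ 2 ^ i).
Proof.
case/andP=> t_gt0 lt_t; have [o co_o def_t] := pfactor_coprime (isT : prime 2) t_gt0.
exists (logn 2 t) => [|j]; last first.
  rewrite {1}def_t addnC divnMDl ?expn_gt0 // oddD.
  by rewrite coprime2n in co_o; rewrite co_o addTb.
(* Here 2^i <= t < d <= 2^(ceil_log d). *)
rewrite /ceil_log -(@leq_exp2l 2) //.
apply: leq_trans (leq_trans (ltnW lt_t) (up_logP d (isT : 1 < 2))).
by rewrite {2}def_t leq_pmull //; case: o co_o def_t; rewrite // mul0n => _ E; rewrite E in t_gt0.
Qed.

End Marker.

(** * Cost of timed programs *)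

Lemma result_bind (A B : Type) (x : timed A) (f : A -> timed B) :
  result (bind x f) = result (f (result x)).
Proof. by []. Qed.

Lemma time_bind (A B : Type) (x : timed A) (f : A -> timed B) :
  time (bind x f) = time x + time (f (result x)).
Proof. by []. Qed.

(** Sequencing rule of a small cost logic: the known value [a] enters the continuation, and [T2] is
    the budget left for it. *)
Lemma bind_spec (A B : Type) (t : timed A) (f : A -> timed B) a b T1 T2 T :
    result t = a /\ time t <= T1 -> T1 + T2 <= T ->
    result (f a) = b /\ time (f a) <= T2 ->
  result (bind t f) = b /\ time (bind t f) <= T.
Proof.
move=> [<- le_T1] le_T [<- le_T2]; split=> //; apply: leq_trans le_T.
exact: leq_add.
Qed.

Lemma sum_rot (E : nat -> nat) (n c : nat) : c < n ->
  \sum_(0 <= j < n) E ((c + j) %% n) = \sum_(0 <= j < n) E j.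
Proof.
move=> lt_c; rewrite (@big_cat_nat _ _ _ (n - c) 0 n) //=; last by lia.
rewrite [RHS](@big_cat_nat _ _ _ c 0 n) ?(ltnW lt_c) //= addnC.
have := sum_shift E c (n - c); rewrite subnKC ?(ltnW lt_c) // => ->.
have := sum_shift (fun j => E ((c + j) %% n)) (n - c) c; rewrite subnK ?(ltnW lt_c) // => ->.
congr (_ + _); apply: eq_big_nat => j /andP[_ lt_j]; last by rewrite modn_small //; lia.
by rewrite addnA subnKC ?(ltnW lt_c) // modnDl modn_small //; lia.
Qed.

Lemma big_iota (F : nat -> nat) (N : nat) :
  \sum_(j <- iota 0 N) F j = \sum_(0 <= j < N) F j.
Proof. by rewrite /index_iota subn0. Qed.

(** With t the integer part of log x, this is (t + 1)^2 <= 4 * 2^t, and 2^t <= x. *)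
Lemma sqr_bits x : 0 < x -> bits x * bits x <= 4 * x.
Proof.
move=> x_gt0; have /= le_x := trunc_logP (isT : 1 < 2) x_gt0.
apply: leq_trans (leq_mul (leqnn 4) le_x); rewrite /bits.
case: (trunc_log 2 x) => [|[|t]] //; elim: t => // t IHt; rewrite expnS; nia.
Qed.

Lemma leq_bits x y : x <= y -> bits x <= bits y.
Proof. by move=> le_xy; rewrite ltnS leq_trunc_log. Qed.

Lemma bits_mul x y : bits (x * y) <= bits x + bits y.
Proof.
have [-> | xy_gt0] := posnP (x * y); first by rewrite /bits trunc_log0.
rewrite -(@ltn_exp2l 2) // expnD; apply: leq_ltn_trans (trunc_logP _ xy_gt0) _ => //.
by apply: ltn_mul; apply: trunc_log_ltn.
Qed.

Section Cost.
Variable n : nat.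
Hypothesis n_gt0 : 0 < n.

(* Bounds one machine operation on numbers of size O(n), as (log n)^2 = O(n). *)
Definition op_cost : nat := 64 * n.
Local Notation G := op_cost.

Let bits8 : bits (8 * n) * bits (8 * n) <= 32 * n.
Proof. by apply: leq_trans (sqr_bits _) _; lia. Qed.

Lemma product_cost_le x y : x <= 8 * n -> y <= 8 * n -> product_cost x y <= G.
Proof.
move=> /leq_bits le_x /leq_bits le_y; apply: leq_trans (leq_mul le_x le_y) _.
by rewrite /op_cost; lia.
Qed.

(** The extra [n] pays for a memory cell of at most [n] bits next to its address. *)
Lemma bits_le x : x <= 8 * n -> bits x + n <= G.
Proof.
move=> /leq_bits le_x; move: bits8; rewrite /op_cost; move: (bits (8 * n)) le_x => B; nia.
Qed.

Lemma linear_cost_le x y : x <= 8 * n -> y <= 8 * n -> linear_cost x y <= G.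
Proof.
move=> /leq_bits le_x /leq_bits le_y; rewrite /linear_cost.
move: bits8; rewrite /op_cost; move: (bits (8 * n)) le_x le_y => B; nia.
Qed.

(** Invariant rule: [spec j] is the exact accumulator after [j] rounds. Each round pays [T] for the
    body and [G] for the counter. *)
Lemma loop_spec (A : Type) (spec : nat -> A) k (body : nat -> A -> timed A) T a :
    a = spec 0 -> k <= 8 * n ->
    (forall j, j < k -> result (body j (spec j)) = spec j.+1 /\ time (body j (spec j)) <= T) ->
  result (loop k body a) = spec k /\ time (loop k body a) <= k * (T + G).
Proof.
move=> -> le_k bodyP; rewrite /loop.
(* The starting counter is generalised with [j + l = k] fixed, so the loop bound stays the same
   throughout the induction. *)
suff loopP l j : j + l = k ->
    result (loop_from j l body (spec j)) = spec k /\
    time (loop_from j l body (spec j)) <= l * (T + G) by apply: loopP.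
elim: l j => [|l IHl] j def_k; first by rewrite /= -def_k addn0.
have [|res_j le_T] := bodyP j; first by lia.
have [|resl timel] := IHl j.+1; first by lia.
rewrite /= res_j; split=> //.
have := @linear_cost_le j (j + l.+1); rewrite /op_cost in timel *; lia.
Qed.

Lemma copy_spec (A : Type) (x0 : A) c x i len acc :
    c <= n -> i + len <= 8 * n -> size acc + len <= 8 * n ->
  result (copy x0 c x i len acc) = acc ++ [seq nth x0 x (i + j) | j <- iota 0 len] /\
  time (copy x0 c x i len acc) <= len * (4 * G).
Proof.
move=> le_c le_i le_acc; rewrite /copy.
pose spec l := acc ++ [seq nth x0 x (i + j) | j <- iota 0 l].
have -> : len * (4 * G) = len * (3 * G + G) by lia.
apply: (loop_spec (spec := spec)) => [||j lt_j]; [by rewrite /spec cats0 | by lia |].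
split; first by rewrite /spec -[j.+1]addn1 iotaD map_cat catA cats1.
rewrite /= size_cat size_map size_iota.
have := @linear_cost_le i j; have := @bits_le (i + j); have := @bits_le (size acc + j).
rewrite /op_cost; lia.
Qed.

End Cost.

(** * Uniqueness of the marker *)

Section Code.
Variables d n : nat.

Local Notation m := (m_par n).
Local Notation lp := (ell_p d n).
Local Notation nR := (n_R d n).
Local Notation kR := (k_R d n).
Local Notation p := (p_word d n).

(** All that is used of [n] being large and of integrality. The last equation measures a block:
    marker, information symbols, and [2 * d + 2] parity fields of [m + d] bits. *)
Definition large_params := [/\ 0 < d, ell d <= m, 1 < kR, nR = kR + 2 * d + 2
  & n = lp + m * kR + (m + d) * (2 * d + 2)].

Hypothesis large : large_params.

Let d_gt0 : 0 < d. Proof. by case: large. Qed.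
Let le_ell : ell d <= m. Proof. by case: large. Qed.
Let le_d : 2 * d <= ell d. Proof. by rewrite /ell; lia. Qed.
Let kR_gt1 : 1 < kR. Proof. by case: large. Qed.
Let nRE : nR = kR + 2 * d + 2. Proof. by case: large. Qed.
Let nE : n = lp + m * kR + (m + d) * (2 * d + 2). Proof. by case: large. Qed.
Let lpE : lp = 3 * m + ell d. Proof. by []. Qed.

Lemma size_p_word : size p = lp.
Proof. by rewrite size_cat size_nseq size_u_word. Qed.

Lemma nth_p_word_zeros j : j < 3 * m -> nth false p j = false.
Proof. by move=> lt_j; rewrite nth_cat size_nseq lt_j nth_nseq if_same. Qed.

Lemma nth_p_word_u j : nth false p (3 * m + j) = nth false (u_word d) j.
Proof. by rewrite nth_cat size_nseq ltnNge leq_addr addKn. Qed.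

Lemma nth_p_word_ones j : j < d -> nth false p (3 * m + j).
Proof. by move=> lt_j; rewrite nth_p_word_u nth_u_word_ones. Qed.

Lemma nth_p_word_block i j : i <= ceil_log d -> j < d ->
  nth false p (3 * m + d + i * d + j) = ~~ odd (j %/ 2 ^ i).
Proof.
move=> le_i lt_j; have -> : 3 * m + d + i * d + j = 3 * m + (d + i * d + j) by lia.
by rewrite nth_p_word_u nth_u_word_block.
Qed.

Section MarkerUnique.
(** [V] is abstract because a rotated window mixes two consecutive blocks; the hypotheses below are
    what survives the mixing. *)
Variable V : nat -> bool.
Hypothesis V_p : forall j, j < lp -> V j = nth false p j.
Hypothesis V_ones : forall j r, j < 2 * d + 2 -> r < d ->
  V (lp + m * kR + (m + d) * j + r).
Hypothesis V_info : forall j, j.+1 < kR ->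
  exists2 i, (i == j) || (i == j.+1) & d <= \sum_(0 <= r < m) V (lp + m * i + r).

Let D t := \sum_(0 <= j < lp) (V ((t + j) %% n) != nth false p j).

(** A stretch of [V] facing only the zeros of [p] contributes its whole weight to the distance. *)
Let zeros_vs_heavy t y len : t <= y -> y + len <= t + 3 * m -> y + len <= n ->
  d <= \sum_(0 <= r < len) V (y + r) -> d <= D t.
Proof.
move=> le_t le_k le_n heavy; apply: leq_trans heavy _.
pose F j := nat_of_bool (V ((t + j) %% n) != nth false p j).
apply: leq_trans (@leq_sum_subrange F (y - t) len lp _); last by lia.
rewrite big_nat [leqRHS]big_nat; apply: leq_sum => r /= lt_r; rewrite /F.
rewrite nth_p_word_zeros; last by lia.
rewrite modn_small; last by lia.
by rewrite addnA subnKC //; case: (V _).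
Qed.

Let zeros_vs_ones t y : t <= y -> y + d <= t + 3 * m -> y + d <= n ->
  (forall r, r < d -> V (y + r)) -> d <= D t.
Proof. by move=> le_t le_k le_n V1; apply: (zeros_vs_heavy le_t le_k le_n); rewrite sum_true. Qed.

Let shift_inside t : lp <= t -> t + 3 * m <= n -> d <= D t.
Proof.
(* [j] is the first information symbol starting at or after [t]. It starts before [t + m], so both
   [j] and [j + 1] end within the [3 * m] zeros, and one of them is heavy. *)
move=> le_t le_n; have [le_info | gt_info] := leqP (t + 3 * m) (lp + m * kR + d).
  pose j := (t - lp + m.-1) %/ m.
  have m_gt0 : 0 < m by lia.
  have := divn_eq (t - lp + m.-1) m; rewrite -/j => Ej.
  have lt_rem : (t - lp + m.-1) %% m < m by rewrite ltn_mod.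
  have lt_j : j.+1 < kR by nia.
  have [i /orP[]/eqP-> heavy] := V_info lt_j; apply: (zeros_vs_heavy _ _ _ heavy); nia.
(* The zeros begin no later than the parity part and reach past its first field of ones. *)
have [le_mk | gt_mk] := leqP t (lp + m * kR).
  apply: (@zeros_vs_ones _ (lp + m * kR)) => //; try lia.
  by move=> r lt_r; have := @V_ones 0 r _ lt_r; rewrite muln0 addn0; apply; lia.
(* The first parity field starting at or after [t]: its ones end before [t + m + 2 * d], which is at
   most [t + 3 * m]. *)
pose j := (t - (lp + m * kR) + (m + d).-1) %/ (m + d).
have := divn_eq (t - (lp + m * kR) + (m + d).-1) (m + d); rewrite -/j => Ej.
have lt_rem : (t - (lp + m * kR) + (m + d).-1) %% (m + d) < m + d by rewrite ltn_mod; lia.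
apply: (@zeros_vs_ones _ (lp + m * kR + (m + d) * j)); try nia.
by move=> r lt_r; apply: V_ones => //; nia.
Qed.

Let shift_right t : d <= t < lp -> d <= D t.
Proof.
case/andP=> ge_d lt_lp; have [le_k | gt_k] := leqP t (3 * m).
  apply: (@zeros_vs_ones _ (3 * m)); try lia.
  by move=> r lt_r; rewrite V_p ?nth_p_word_ones //; lia.
(* Since [t > 3 * m] and [ell d <= m], the zeros cover the first two information symbols, which end
   at [lp + 2 * m]. *)
have [i i01 heavy] := V_info kR_gt1.
apply: (zeros_vs_heavy _ _ _ heavy); case/orP: i01 => /eqP->; nia.
Qed.

(** The window wraps round the end of the block, so the ones opening the [u] part of [p] face zeros
    of the marker of [V]. *)
Let shift_left t : n - 3 * m < t <= n - d -> d <= D t.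
Proof.
case/andP=> gt_t le_t.
pose F j := nat_of_bool (V ((t + j) %% n) != nth false p j).
apply: leq_trans (@leq_sum_subrange F (3 * m) d lp _); last by lia.
rewrite /F sum_true // => r lt_r; rewrite nth_p_word_ones //.
have -> : t + (3 * m + r) = (t + 3 * m - n + r) + n by lia.
rewrite modnDr modn_small; last by lia.
by rewrite V_p ?nth_p_word_zeros //; lia.
Qed.

Let small_shift_right t : 0 < t < d -> d <= D t.
Proof.
move=> t_d; have /andP[t_gt0 lt_t] := t_d; have [i le_i odd_i] := u_block_shift t_d.
pose F j := nat_of_bool (V ((t + j) %% n) != nth false p j).
have le_id : i * d + d <= ell d - d by rewrite /ell; nia.
(* The last [t] zeros of [p] face the first [t] ones of u; the first [d - t] bits of u_i face the
   same field shifted by [t], its complement there. *)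
apply: leq_trans (@leq_sum_subranges F (3 * m - t) t (3 * m + d + i * d) (d - t) lp _ _);
  try lia.
rewrite /F !sum_true; first by lia.
  move=> j lt_j; rewrite modn_small; last by lia.
  rewrite nth_p_word_block //; last by lia.
  have -> : t + (3 * m + d + i * d + j) = 3 * m + d + i * d + (j + t) by lia.
  rewrite V_p; last by lia.
  by rewrite nth_p_word_block // ?odd_i; [case: (odd _) | lia].
move=> j lt_j; rewrite modn_small; last by lia.
rewrite nth_p_word_zeros; last by lia.
rewrite addnA subnKC; last by lia.
by rewrite V_p ?nth_p_word_ones //; lia.
Qed.

Let small_shift_left s : 0 < s < d -> d <= D (n - s).
Proof.
move=> s_d; have /andP[s_gt0 lt_s] := s_d; have [i le_i odd_i] := u_block_shift s_d.
pose F j := nat_of_bool (V ((n - s + j) %% n) != nth false p j).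
have le_id : i * d + d <= ell d - d by rewrite /ell; nia.
(* A left shift by [s] is the cyclic shift [n - s]. The first [s] ones of [p] face zeros, and the
   last [d - s] bits of u_i face the first [d - s] ones of its positions. *)
apply: leq_trans (@leq_sum_subranges F (3 * m) s (3 * m + d + i * d + s) (d - s) lp _ _);
  try lia.
have shiftE j : s <= j -> j < lp -> (n - s + j) %% n = j - s.
  move=> le_j lt_j; have -> : n - s + j = j - s + n by lia.
  by rewrite modnDr modn_small //; lia.
rewrite /F !sum_true; first by lia.
  move=> j lt_j; rewrite shiftE; [ | by lia | by lia].
  have -> : 3 * m + d + i * d + s + j - s = 3 * m + d + i * d + j by lia.
  rewrite V_p; last by lia.
  rewrite nth_p_word_block //; last by lia.
  rewrite -addnA [s + j]addnC nth_p_word_block // ?odd_i; last by lia.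
  by case: (odd _).
move=> j lt_j; rewrite shiftE; [ | by lia | by lia].
rewrite nth_p_word_ones; last by lia.
by rewrite V_p ?nth_p_word_zeros //; lia.
Qed.

Lemma marker_unique t : 0 < t < n ->
  d <= \sum_(0 <= j < lp) (V ((t + j) %% n) != nth false p j).
Proof.
case/andP=> t_gt0 lt_n; rewrite -/(D t).
have [lt_d | ge_d] := ltnP t d; first by apply: small_shift_right; lia.
have [lt_lp | ge_lp] := ltnP t lp; first by apply: shift_right; lia.
have [le_n | gt_n] := leqP (t + 3 * m) n; first exact: shift_inside.
have [le_nd | gt_nd] := leqP t (n - d); first by apply: shift_left; lia.
have -> : t = n - (n - t) by lia.
by apply: small_shift_left; lia.
Qed.

End MarkerUnique.

(** * Blocks of the sequence *)

Variable K : construction1A d n.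
Local Notation F := (Fq K).

Section Block.
Variable x : kR.-tuple F.

Definition block : seq bool := p ++ s_word (enc x).

Let size_phi (a : F) : size (val (phi a)) = m. Proof. exact: size_tuple. Qed.

Let size_parity (a : F) : size (nseq d true ++ val (phi a)) = m + d.
Proof. by rewrite size_cat size_nseq size_tuple addnC. Qed.

Let size_info : size (flatten [seq val (phi a) | a <- take kR (enc x)]) = m * kR.
Proof.
by rewrite (size_flatten_blocks size_phi) size_takel ?size_tuple 1?mulnC // nRE; lia.
Qed.

Lemma size_block : size block = n.
Proof.
rewrite /block size_cat size_p_word /s_word size_cat size_info (size_flatten_blocks size_parity).
by rewrite size_drop size_tuple; rewrite [RHS]nE nRE; lia.
Qed.

Lemma nth_block_p j : j < lp -> nth false block j = nth false p j.
Proof. by move=> lt_j; rewrite /block nth_cat size_p_word lt_j. Qed.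

Lemma nth_block_info j r : j < kR -> r < m ->
  nth false block (lp + m * j + r) = nth false (phi (nth 0%R x j)) r.
Proof.
move=> lt_j lt_r; rewrite -addnA /block nth_cat size_p_word ltnNge leq_addr addKn.
rewrite /s_word nth_cat size_info ifT; last by nia.
rewrite enc_systematic [m * j]mulnC (nth_flatten_blocks size_phi _ 0%R) //.
by rewrite size_tuple.
Qed.

Let nth_block_parity_field j r : j < 2 * d + 2 -> r < m + d ->
  nth false block (lp + m * kR + (m + d) * j + r)
    = nth false (nseq d true ++ val (phi (nth 0%R (enc x) (kR + j)))) r.
Proof.
move=> lt_j lt_r.
have -> : lp + m * kR + (m + d) * j + r = lp + (m * kR + (j * (m + d) + r)) by lia.
rewrite /block nth_cat size_p_word ltnNge leq_addr addKn.
rewrite /s_word nth_cat size_info ltnNge leq_addr addKn.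
rewrite (nth_flatten_blocks size_parity _ 0%R) // ?nth_drop //.
by rewrite size_drop size_tuple nRE; lia.
Qed.

Lemma nth_block_ones j r : j < 2 * d + 2 -> r < d ->
  nth false block (lp + m * kR + (m + d) * j + r).
Proof.
move=> lt_j lt_r; rewrite nth_block_parity_field //; last by lia.
by rewrite nth_cat size_nseq lt_r nth_nseq lt_r.
Qed.

Lemma nth_block_parity j r : j < 2 * d + 2 -> r < m ->
  nth false block (lp + m * kR + (m + d) * j + d + r)
    = nth false (phi (nth 0%R (enc x) (kR + j))) r.
Proof.
move=> lt_j lt_r; rewrite -[_ + d + r]addnA nth_block_parity_field //; last by lia.
by rewrite nth_cat size_nseq ltnNge leq_addr addKn.
Qed.

End Block.

(** * Symbols of a block and of a mixture of two blocks *)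

(** Where the [m] bits of symbol [j] start in a block; the final [+ d] skips the ones in front of a
    parity symbol. *)
Definition sym_pos (j : nat) : nat :=
  if j < kR then lp + m * j else lp + m * kR + (m + d) * (j - kR) + d.

Lemma nth_block_sym x j r : j < nR -> r < m ->
  nth false (block x) (sym_pos j + r) = nth false (phi (nth 0%R (enc x) j)) r.
Proof.
rewrite /sym_pos => lt_j lt_r; case: ltnP => [lt_kR | ge_kR].
  by rewrite nth_block_info // -[in LHS](enc_systematic x) nth_take.
by rewrite nth_block_parity ?subnKC //; move: lt_j; rewrite nRE; lia.
Qed.

(* The uncorrupted window S[a n + b, a n + b + n - 1], rotated so that a marker comes
   first, where x and x' are the Gray codewords of index a and a + 1. *)
Definition mixed_block (x x' : kR.-tuple F) (b j : nat) : bool :=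
  nth false (block (if j < b then x' else x)) j.

Section MixedBlock.
Variables (x x' : kR.-tuple F) (b : nat).
Local Notation V := (mixed_block x x' b).

Lemma mixed_block_sym j r : j < nR -> r < m ->
  V (sym_pos j + r) = nth false (phi (nth 0%R (enc (if sym_pos j + r < b then x' else x)) j)) r.
Proof. exact: nth_block_sym. Qed.

Hypotheses (xX : all (fun a => a \in Xset K) x) (xX' : all (fun a => a \in Xset K) x').

(* At most one symbol is cut by the boundary b, so one of two neighbours is intact. *)
Lemma mixed_block_info j : j.+1 < kR ->
  exists2 i, (i == j) || (i == j.+1) & d <= \sum_(0 <= r < m) V (lp + m * i + r).
Proof.
(* If [b] is at most the start of symbol [j + 1], that symbol lies wholly in [x]; otherwise symbol
   [j] ends before [b] and lies wholly in [x']. *)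
move=> lt_j; pose i := if b <= lp + m * j.+1 then j.+1 else j.
exists i; first by rewrite /i; case: ifP; rewrite eqxx ?orbT.
have lt_i : i < kR by rewrite /i; case: ifP; lia.
pose y := if b <= lp + m * j.+1 then x else x'.
have Vy r : r < m -> V (lp + m * i + r) = nth false (phi (nth 0%R y i)) r.
  move=> lt_r; rewrite -nth_block_info // /mixed_block /y /i.
  by case: (leqP b (lp + m * j.+1)) => cmp; [rewrite ifF // | rewrite ifT //]; nia.
have /(all_nthP 0%R)/(_ i) : all (fun a => a \in Xset K) y by rewrite /y; case: ifP.
rewrite size_tuple => /(_ lt_i); rewrite inE hamming_weightE size_tuple => /leq_trans; apply.
by rewrite big_nat [leqRHS]big_nat; apply: leq_sum => r /= lt_r; rewrite Vy.
Qed.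

Lemma mixed_block_marker_unique t : 0 < t < n ->
  d <= \sum_(0 <= j < lp) (V ((t + j) %% n) != nth false p j).
Proof.
apply: marker_unique => [j lt_j | j r lt_j lt_r |]; last exact: mixed_block_info.
  exact: nth_block_p.
exact: nth_block_ones.
Qed.

End MixedBlock.

(** * The loops of the algorithm *)

Local Notation G := (op_cost n).

Let m_gt0 : 0 < m. Proof. by lia. Qed.
Let n_gt0 : 0 < n. Proof. by lia. Qed.
Let le_nG : n <= G. Proof. by rewrite /op_cost; lia. Qed.
Let le_lp : lp <= n. Proof. by lia. Qed.
Let le_kR : kR <= n. Proof. by have := leq_pmull kR m_gt0; lia. Qed.
Let le_mnR : m * nR <= n. Proof. by rewrite nRE; nia. Qed.
Let le_nR : nR <= n. Proof. by have := leq_pmull nR m_gt0; lia. Qed.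

(** Abstracts every operation cost in the goal to a variable bounded through [G], leaving linear
    arithmetic. *)
Ltac op_bounds := repeat match goal with
  | |- context [linear_cost ?x ?y] =>
    have : linear_cost x y <= G; [apply: linear_cost_le; [done | lia | lia] |];
    move: (linear_cost x y) => ?
  | |- context [product_cost ?x ?y] =>
    have : product_cost x y <= G; [apply: product_cost_le; [done | lia | lia] |];
    move: (product_cost x y) => ?
  | |- context [bits ?x] =>
    have : bits x + n <= G; [apply: bits_le; [done | lia] |];
    move: (bits x) => ?
  end.

Section Search.
Variable w : seq bool.

Definition window_mismatch (i : nat) : nat :=
  \sum_(0 <= j < lp) (nth false w ((i + j) %% n) != nth false p j).

Lemma window_dist_spec i : i <= n ->
  result (window_dist d n w i) = window_mismatch i /\
  time (window_dist d n w i) <= lp * (8 * G).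
Proof.
move=> le_i; have -> : lp * (8 * G) = lp * (7 * G + G) by lia.
pose spec j := \sum_(0 <= j' < j) (nth false w ((i + j') %% n) != nth false p j').
apply: (loop_spec n_gt0 (spec := spec)) => [||j lt_j]; [by rewrite /spec big_geq | by lia |].
rewrite /spec big_nat_recr //= -/(spec j).
have le_spec : spec j <= n.
  apply: (@leq_trans (\sum_(0 <= j' < j) 1)); first by apply: leq_sum => j' _; case: (_ == _).
  by rewrite sum_nat_const_nat; lia.
have lt_mod : (i + j) %% n < n by rewrite ltn_mod.
case: (_ == _) => /=; (split; first by rewrite ?addn0 ?addn1).
  by rewrite /nat_timed /=; move: (_ %% n) lt_mod => q lt_q; op_bounds; lia.
move: (spec j) le_spec (_ %% n) lt_mod => h le_h q lt_q.
by rewrite /nat_timed /=; op_bounds; lia.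
Qed.

Definition is_candidate (i : nat) : bool := 2 * window_mismatch i <= d - 1.

Lemma candidates_spec :
  result (candidates d n w) = [seq i <- iota 0 n | is_candidate i] /\
  time (candidates d n w) <= n * (lp * (8 * G) + 8 * G).
Proof.
have -> : lp * (8 * G) + 8 * G = lp * (8 * G) + 7 * G + G by lia.
pose spec j := [seq i <- iota 0 j | is_candidate i].
apply: (loop_spec n_gt0 (spec := spec)) => // [|i lt_i]; first by lia.
have [res_i time_i] := window_dist_spec (ltnW lt_i).
rewrite /= res_i /spec -[i.+1]addn1 iotaD filter_cat /= /is_candidate.
have le_win : window_mismatch i <= lp.
  apply: (@leq_trans (\sum_(0 <= j < lp) 1)); first by apply: leq_sum => j' _; case: (_ == _).
  by rewrite sum_nat_const_nat; lia.
have le_size : size (spec i) <= i by rewrite size_filter -[leqRHS](size_iota 0) count_size.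
case: ifP => _ /=; split; rewrite ?cats1 ?cats0 //.
  rewrite -/(is_candidate _) -/(spec i).
  move: (time _) time_i (size _) le_size => tm time_i sz le_size; op_bounds; lia.
move: time_i; move: (time _) => tm; op_bounds; lia.
Qed.

Lemma rotate_spec c : c <= n ->
  result (rotate n w c) = [seq nth false w ((c + j) %% n) | j <- iota 0 n] /\
  time (rotate n w c) <= n * (5 * G).
Proof.
move=> le_c; have -> : n * (5 * G) = n * (4 * G + G) by lia.
pose spec k := [seq nth false w ((c + j) %% n) | j <- iota 0 k].
apply: (loop_spec n_gt0 (spec := spec)) => // [|j lt_j]; first by lia.
have lt_mod : (c + j) %% n < n by rewrite ltn_mod.
rewrite /spec -[j.+1]addn1 iotaD map_cat /= cats1; split=> //.
by rewrite /nat_timed /= size_map size_iota; move: (_ %% n) lt_mod => q lt_q; op_bounds; lia.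
Qed.

End Search.

Definition is_deleted (j : nat) : bool :=
  (j < lp) || has (fun j' => (lp + m * kR + (m + d) * j' <= j)
                             && (j <= lp + m * kR + (m + d) * j' + d - 1)) (iota 0 (nR - kR)).

(** The number of parity fields tested is bounded crudely by [n]; with the outer loop this is still
    O(n^2) operations. *)
Lemma deleted_spec j : j < n ->
  result (deleted d n j) = is_deleted j /\ time (deleted d n j) <= n * (14 * G).
Proof.
move=> lt_j; have le_G : 14 * G <= n * (14 * G) by rewrite leq_pmull.
rewrite /deleted /is_deleted /=; case: ltnP => le_j /=.
  by split=> //; op_bounds; lia.
pose start j' := lp + m * kR + (m + d) * j'.
pose spec k := has (fun j' => (start j' <= j) && (j <= start j' + d - 1)) (iota 0 k).
set body := (X in loop _ X _).
have [||j' lt_j'|-> le_t] := @loop_spec n n_gt0 _ spec (nR - kR) body (12 * G) false.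
- by [].
- by rewrite nRE; nia.
- have lt_j2 : j' < 2 * d + 2 by move: lt_j'; rewrite nRE; lia.
  have := leq_mul (leqnn (m + d)) lt_j2; rewrite mulnS => le_j'.
  have ge_j' : j' <= (m + d) * j' by rewrite leq_pmull //; lia.
  rewrite /spec -[j'.+1]addn1 iotaD has_cat /= orbF; split=> //.
  rewrite /nat_timed /=; op_bounds; lia.
split=> //; have le_nG1 : G <= n * G by rewrite leq_pmull.
have le_nkR : (nR - kR) * (12 * G + G) <= n * (13 * G).
  by apply: leq_mul; lia.
by move: le_t; op_bounds; lia.
Qed.

Lemma delete_markers_spec v :
  result (delete_markers d n v) = [seq nth false v j | j <- iota 0 n & ~~ is_deleted j] /\
  time (delete_markers d n v) <= n * (n * (14 * G) + 3 * G).
Proof.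
have -> : n * (14 * G) + 3 * G = n * (14 * G) + 2 * G + G by lia.
pose spec k := [seq nth false v j | j <- iota 0 k & ~~ is_deleted j].
apply: (loop_spec n_gt0 (spec := spec)) => // [|j lt_j]; first by lia.
have [res_j time_j] := deleted_spec lt_j.
have le_size : size (spec j) <= j.
  by rewrite size_map size_filter -[leqRHS](size_iota 0) count_size.
have -> : spec j.+1 = spec j ++ (if is_deleted j then [::] else [:: nth false v j]).
  by rewrite /spec -[j.+1]addn1 iotaD filter_cat map_cat /=; case: (is_deleted j).
rewrite result_bind time_bind res_j; move: (deleted d n j) time_j => del time_j.
case: (is_deleted j); split; rewrite ?cats1 ?cats0 //=; first by lia.
move: (time _) time_j (size _) le_size => tm time_j sz le_size.
by op_bounds; lia.
Qed.

Definition read_symbol (s : seq bool) (j : nat) : F :=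
  phi_inv K [tuple nth false s (j + t) | t < m].

Lemma read_symbols_spec vhat :
  result (read_symbols K vhat) = [seq read_symbol vhat (m * j) | j <- iota 0 nR] /\
  time (read_symbols K vhat) <= nR * (m * (4 * G) + 6 * G).
Proof.
have le_nR_m : nR <= m * nR by rewrite leq_pmull.
have -> : nR * (m * (4 * G) + 6 * G) = nR * (m * (4 * G) + 5 * G + G) by lia.
pose spec k := [seq read_symbol vhat (m * j) | j <- iota 0 k].
apply: (loop_spec n_gt0 (spec := spec)) => // [|j lt_j]; first by lia.
have := leq_mul (leqnn m) lt_j; rewrite mulnS => le_j.
have [||| res_j time_j] := @copy_spec n n_gt0 _ false 1 vhat (m * j) m [::] => //=; try lia.
rewrite /= res_j /spec -[j.+1]addn1 iotaD map_cat /= cats1; split.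
  congr (rcons _ _); rewrite /read_symbol; congr (phi_inv K _).
  apply: eq_mktuple => t; rewrite (nth_map 0) ?size_iota // nth_iota //.
move: time_j; move: (time (copy _ _ _ _ _ _)) => tm.
by rewrite size_map size_iota; op_bounds; lia.
Qed.

Lemma gray_index_spec decG (c : seq F) :
  let x := [seq nth 0%R c j | j <- iota 0 kR] in
  result (gray_index decG c) = result (decG x) /\
  time (gray_index decG c) <= kR * (4 * G) + time (decG x).
Proof.
have [||| res_c time_c] := @copy_spec n n_gt0 _ (0%R : F) m c 0 kR [::] => //=; try lia.
by rewrite /= res_c leq_add2r; split.
Qed.

(** * Symbol errors and decoding *)

Let iota_nR : iota 0 nR = iota 0 kR ++ iota kR (2 * d + 2).
Proof. by rewrite {1}nRE -addnA iotaD. Qed.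

(** The block is cut into marker, information part and parity part: nothing survives of the first,
    all of the second, and the last [m] bits of each field of the third. *)
Lemma remaining_positions :
  [seq j <- iota 0 n | ~~ is_deleted j] = flatten [seq iota (sym_pos j) m | j <- iota 0 nR].
Proof.
have nRB : nR - kR = 2 * d + 2 by rewrite nRE; lia.
have -> : iota 0 n = iota 0 lp ++ iota lp (m * kR)
                       ++ iota (lp + m * kR) ((m + d) * (2 * d + 2)).
  by rewrite {1}nE (iotaD 0 (lp + m * kR)) (iotaD 0 lp) -catA.
rewrite !filter_cat iota_nR map_cat.
rewrite flatten_cat filter_pred0_in ?cat0s; last first.
  by move=> j; rewrite mem_iota /is_deleted => /andP[_ ->].
congr (_ ++ _).
  rewrite (@eq_in_filter _ _ predT) ?filter_predT.
    rewrite iota_blocks; congr flatten; apply/eq_in_map => j; rewrite mem_iota /sym_pos.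
    by case/andP=> _; rewrite add0n => ->.
  move=> j; rewrite mem_iota /is_deleted => /andP[ge_j lt_j] /=.
  rewrite ltnNge ge_j /=; apply/hasPn => j' _.
  by rewrite negb_and -!ltnNge; apply/orP; left; lia.
have iota_kR := iotaDl kR 0 (2 * d + 2); rewrite addn0 in iota_kR.
rewrite iota_blocks filter_flatten -map_comp iota_kR -map_comp; congr flatten.
apply/eq_in_map => j; rewrite mem_iota => /andP[_ lt_j] /=.
rewrite /sym_pos ltnNge leq_addr addKn [m + d]addnC iotaD filter_cat /=.
rewrite filter_pred0_in ?cat0s; last first.
  move=> y; rewrite mem_iota negbK => /andP[ge_y lt_y]; apply/orP; right.
  by apply/hasP; exists j; [rewrite mem_iota nRB; lia | lia].
rewrite (@eq_in_filter _ _ predT) ?filter_predT //.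
move=> y; rewrite mem_iota => /andP[ge_y lt_y] /=; apply/negP => /orP[|/hasP[j']]; first by lia.
rewrite mem_iota => _ /andP[ge_y' lt_y'].
(* Parity fields start [m + d] apart, so the ones of another field lie wholly before or after field
   [j]. *)
have [lt_jj | gt_jj | eq_jj] := ltngtP j' j.
- by have := leq_mul (leqnn (m + d)) lt_jj; rewrite mulnS; lia.
- by have := leq_mul (leqnn (m + d)) gt_jj; rewrite mulnS; lia.
by rewrite eq_jj in lt_y'; lia.
Qed.

Section Reading.
Variable v : seq bool.

(** Lets the error count be made on the rotated word itself, without the word left after
    deletion. *)
Lemma read_deleted j : j < nR ->
  read_symbol [seq nth false v i | i <- iota 0 n & ~~ is_deleted i] (m * j)
    = read_symbol v (sym_pos j).
Proof.
move=> lt_j; rewrite /read_symbol; congr (phi_inv K _); apply: eq_mktuple => t.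
have size_iota_pos i : size [seq nth false v y | y <- iota (sym_pos i) m] = m.
  by rewrite size_map size_iota.
rewrite remaining_positions map_flatten -map_comp mulnC.
rewrite (nth_flatten_blocks size_iota_pos _ 0) ?size_iota //= nth_iota //.
by rewrite (nth_map 0) ?size_iota // nth_iota.
Qed.

(** The symbols occupy disjoint sets of positions, namely the undeleted ones. *)
Lemma sum_symbols_le (E : nat -> nat) :
  \sum_(j <- iota 0 nR) \sum_(0 <= r < m) E (sym_pos j + r) <= \sum_(0 <= i < n) E i.
Proof.
apply: (@leq_trans (\sum_(i <- [seq i <- iota 0 n | ~~ is_deleted i]) E i)); last first.
  by rewrite big_filter -big_iota [leqRHS](bigID (fun i => ~~ is_deleted i)) leq_addr.
rewrite remaining_positions big_flatten big_map; apply: leq_sum => j _.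
by have := sum_shift E (sym_pos j) m; rewrite /index_iota addKn subn0 => ->.
Qed.

(* An erroneous symbol contains an erroneous bit, unless it already differs in V. *)
Lemma symbol_errors (V : nat -> bool) (c : nat -> F) (bad Q : pred nat) :
    (forall j r, j < nR -> Q j -> ~~ bad j -> r < m ->
       V (sym_pos j + r) = nth false (phi (c j)) r) ->
  \sum_(j <- iota 0 nR | Q j) (read_symbol v (sym_pos j) != c j)
    <= \sum_(0 <= i < n) (nth false v i != V i) + \sum_(j <- iota 0 nR | Q j) bad j.
Proof.
move=> good; pose E i := nat_of_bool (nth false v i != V i).
apply: (@leq_trans (\sum_(j <- iota 0 nR | Q j)
                      (\sum_(0 <= r < m) E (sym_pos j + r) + bad j))); last first.
  rewrite big_split leq_add2r /= -/E; apply: leq_trans (sum_symbols_le E).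
  by rewrite [leqRHS](bigID Q) leq_addr.
rewrite big_seq_cond [leqRHS]big_seq_cond; apply: leq_sum => j /andP[].
rewrite mem_iota => /andP[_ lt_j] Qj; case bad_j: (bad j).
  by rewrite addn1; case: (_ == _).
rewrite addn0; case: eqP => //= neq; rewrite lt0n; apply/negP => /eqP sum0; apply: neq.
rewrite /read_symbol -[RHS](phiK (c j)); congr (phi_inv K _).
apply: eq_from_tnth => t; rewrite tnth_mktuple (tnth_nth false) /=.
rewrite -good ?bad_j //; apply/eqP; apply: contraTT isT => neq.
move/eqP: sum0; rewrite big_mkord sum_nat_eq0 => /forallP/(_ t).
by rewrite /E neq.
Qed.

End Reading.

Section Decoding.
Variables (Cdec : nat) (dec : RS_decoder K).
Hypothesis decP : RS_decoder_spec Cdec dec.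
Variables (Q : pred nat) (J : {set 'I_nR}).
Hypotheses (JQ : J = [set i : 'I_nR | Q i]) (Q_info : forall j, j < kR -> Q j).

Let L := [seq j <- iota 0 nR | Q j].

Let LE : L = iota 0 kR ++ [seq j <- iota kR (2 * d + 2) | Q j].
Proof.
rewrite /L iota_nR filter_cat; congr (_ ++ _).
by apply/all_filterP/allP => j; rewrite mem_iota => /andP[_ /Q_info].
Qed.

(** Links the kept coordinates as the decoder takes them, a set of ordinals, with the increasing
    list of numbers that the copying loops produce. *)
Lemma enum_coords : [seq val i | i <- enum J] = L.
Proof.
rewrite /L -val_enum_ord filter_map; congr map.
by rewrite enumT {1}/enum_mem; apply: eq_filter => i /=; rewrite JQ inE.
Qed.

Lemma decode_coords (x : kR.-tuple F) (f : nat -> F) :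
    2 * (\sum_(j <- iota 0 nR | Q j) (f j != nth 0%R (enc x) j)) <= size L - kR ->
  result (dec J [seq f j | j <- L]) = [seq nth 0%R (enc x) j | j <- L] /\
  time (dec J [seq f j | j <- L]) <= Cdec * n ^ 3.
Proof.
have cardJ : #|J| = size L by rewrite -enum_coords size_map cardE.
have le_J : kR <= #|J| by rewrite cardJ LE size_cat size_iota leq_addr.
have J_info (i : 'I_nR) : i < kR -> i \in J by move=> lt_i; rewrite JQ inE Q_info.
have size_y : size [seq f j | j <- L] = #|J| by rewrite size_map cardJ.
have [timeP resP] := decP le_J J_info size_y.
move=> few; split=> //; apply: resP; last by rewrite hamming_dist_map cardJ big_filter.
(* The polynomial of the full codeword also witnesses its restriction to the kept points. *)
have [g le_g enc_g] := enc_code x; exists g => //.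
rewrite -enum_coords -!map_comp; apply: eq_map => i /=.
by rewrite enc_g (nth_map 0%R) ?size_tuple // (tnth_nth 0%R).
Qed.

Lemma nth_decoded (x : kR.-tuple F) j : j < kR ->
  nth 0%R [seq nth 0%R (enc x) j | j <- L] j = nth 0%R x j.
Proof.
move=> lt_j; rewrite (nth_map 0); last by rewrite LE size_cat size_iota; lia.
by rewrite LE nth_cat size_iota lt_j nth_iota // -[in RHS](enc_systematic x) nth_take.
Qed.

End Decoding.

(** * Correctness and cost of the whole algorithm *)

Section Locating.
Variables (dec : RS_decoder K) (decG : Gray_decoder K) (Cdec TG e : nat).
Hypotheses (decP : RS_decoder_spec Cdec dec) (few_errors : 2 * e < d).
Variables (x x' : kR.-tuple F) (b a : nat).
Hypotheses (xX : all (fun c => c \in Xset K) x) (xX' : all (fun c => c \in Xset K) x').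
Hypothesis gray_neighbours : \sum_(0 <= j < kR) (nth 0%R x j != nth 0%R x' j) <= 1.
Hypothesis lt_b : b < n.
Hypothesis gray_x : result (decG x) = a /\ time (decG x) <= TG.
Hypothesis gray_x' : 0 < b -> result (decG x') = a.+1 /\ time (decG x') <= TG.
Hypothesis bits_a : bits a.+1 <= n.

Local Notation V := (mixed_block x x' b).

Section FindBlock.
Variable v : seq bool.
Hypothesis v_errors : \sum_(0 <= i < n) (nth false v i != V i) <= e.

Let f j := read_symbol v (sym_pos j).

(** Common core of the three cases: [y] is the Gray codeword to be recovered, and [bad] marks the
    symbols that may differ from [enc y] before any corruption. *)
Lemma decode_and_index (Q : pred nat) (J : {set 'I_nR}) (y : kR.-tuple F) (bad : pred nat) :
    J = [set i : 'I_nR | Q i] -> (forall j, j < kR -> Q j) ->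
    (forall j r, j < nR -> Q j -> ~~ bad j -> r < m ->
       V (sym_pos j + r) = nth false (phi (nth 0%R (enc y) j)) r) ->
    2 * (e + \sum_(j <- iota 0 nR | Q j) bad j) <= size [seq j <- iota 0 nR | Q j] - kR ->
  let c := dec J [seq f j | j <- [seq j <- iota 0 nR | Q j]] in
  time c <= Cdec * n ^ 3 /\
  result (gray_index decG (result c)) = result (decG y) /\
  time (gray_index decG (result c)) <= kR * (4 * G) + time (decG y).
Proof.
move=> JQ Q_info good few.
have [|res_c time_c] := decode_coords decP JQ Q_info (x := y) (f := f).
  apply: leq_trans few; rewrite leq_mul2l /=; apply: leq_trans (symbol_errors v good) _.
  by rewrite leq_add2r.
split=> //; have [-> le_t] := gray_index_spec decG
  (result (dec J [seq f j | j <- [seq j <- iota 0 nR | Q j]])).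
suff def_y : [seq nth 0%R (result (dec J [seq f j | j <- [seq j <- iota 0 nR | Q j]])) j
             | j <- iota 0 kR] = y by rewrite def_y in le_t *.
apply: (@eq_from_nth _ 0%R); rewrite size_map size_iota ?size_tuple // => j lt_j.
by rewrite (nth_map 0) ?size_iota // nth_iota // add0n res_c nth_decoded.
Qed.

Let bad j := (j < kR) && (nth 0%R x j != nth 0%R x' j).

Let bad_le1 (Q : pred nat) : \sum_(j <- iota 0 nR | Q j) bad j <= 1.
Proof.
apply: (@leq_trans (\sum_(j <- iota 0 nR) bad j)).
  by rewrite [leqRHS](bigID Q) leq_addr.
rewrite iota_nR big_cat /= [X in _ + X]big1_seq ?addn0; last first.
  by move=> j /andP[_]; rewrite mem_iota /bad => /andP[ge_j _]; rewrite ltnNge ge_j.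
rewrite (big_iota bad kR); apply: leq_trans gray_neighbours; rewrite big_nat [leqRHS]big_nat.
by apply: leq_sum => j /= lt_j; rewrite /bad lt_j.
Qed.

Let nth_enc (y : kR.-tuple F) j : j < kR -> nth 0%R (enc y) j = nth 0%R y j.
Proof. by move=> lt_j; rewrite -[in RHS](enc_systematic y) nth_take. Qed.

(** An information symbol on which [x] and [x'] agree reads the same even if cut by [b]; a parity
    symbol starting at or after [b] comes from [x]. *)
Let good_x j r : j < nR -> ~~ bad j -> r < m -> (kR <= j -> b <= sym_pos j) ->
  V (sym_pos j + r) = nth false (phi (nth 0%R (enc x) j)) r.
Proof.
move=> lt_j good lt_r after_b; rewrite mixed_block_sym //.
have [lt_kR | /after_b le_b] := ltnP j kR; last by rewrite ltnNge (leq_trans le_b) ?leq_addr.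
case: ifP => // _; rewrite !nth_enc //.
by move: good; rewrite /bad lt_kR negbK => /eqP ->.
Qed.

Let cbar := [seq f j | j <- iota 0 nR].

Let nth_cbar s len : s + len <= nR ->
  [seq nth 0%R cbar (s + j) | j <- iota 0 len] = [seq f j | j <- iota s len].
Proof.
move=> le_s; have := iotaDl s 0 len; rewrite addn0 => ->; rewrite -map_comp.
apply/eq_in_map => j; rewrite mem_iota => /andP[_ lt_j] /=.
by rewrite (nth_map 0) ?size_iota ?nth_iota //; lia.
Qed.

Let iota_nR3 : iota 0 nR = iota 0 kR ++ iota kR d.+1 ++ iota (kR + d + 1) (nR - (kR + d + 1)).
Proof.
have -> : nR - (kR + d + 1) = d.+1 by move: nRE; lia.
have -> : kR + d + 1 = kR + d.+1 by lia.
by rewrite -iotaD iota_nR; congr (_ ++ iota _ _); lia.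
Qed.

Let outer j := (j < kR) || (kR + d + 1 <= j).
Let inner j := j <= kR + d.

Let outerE : [seq j <- iota 0 nR | outer j] = iota 0 kR ++ iota (kR + d + 1) (nR - (kR + d + 1)).
Proof.
rewrite iota_nR3 !filter_cat; congr (_ ++ _); last rewrite filter_pred0_in ?cat0s.
- by apply/all_filterP/allP => j; rewrite mem_iota /outer; lia.
- by apply/all_filterP/allP => j; rewrite mem_iota /outer; lia.
by move=> j; rewrite mem_iota /outer; lia.
Qed.

Let innerE : [seq j <- iota 0 nR | inner j] = iota 0 (kR + d + 1).
Proof.
have -> : kR + d + 1 = kR + d.+1 by lia.
rewrite iota_nR3 !filter_cat [in RHS]iotaD; congr (_ ++ _); last first.
  rewrite [X in _ ++ X]filter_pred0_in ?cats0; last by move=> j; rewrite mem_iota /inner; lia.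
  by apply/all_filterP/allP => j; rewrite mem_iota /inner; lia.
by apply/all_filterP/allP => j; rewrite mem_iota /inner; lia.
Qed.

Let le_parity : (d + 1) * (m + d) <= (m + d) * (2 * d + 2).
Proof. by rewrite mulnC leq_mul2l; apply/orP; right; lia. Qed.

Lemma find_block_spec :
  result (find_block dec decG cbar b) = a /\
  time (find_block dec decG cbar b) <= Cdec * n ^ 3 + TG + n * (30 * G).
Proof.
have le_G : G <= n * G by rewrite leq_pmull.
have le_kRG : kR * (4 * G) <= n * (4 * G) by rewrite leq_mul2r le_kR orbT.
have le_len len : len <= nR -> len * (4 * G) <= n * (4 * G).
  by move=> le_len; rewrite leq_mul2r (leq_trans le_len) ?orbT.
apply: (@bind_spec _ _ _ _ (b <= lp + m * kR - 1) _ (4 * G)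
          (Cdec * n ^ 3 + TG + n * (26 * G))); [|by lia|].
  by rewrite /=; split=> //; op_bounds; lia.
(* First case: all parity symbols come from [x], and at most [e + 1] errors face redundancy
   [2 * d + 2]. *)
case: (leqP b (lp + m * kR - 1)) => [le1 | gt1].
  have [||||time_c [res_g time_g]] := @decode_and_index predT (all_coords d n) x bad.
  - by apply/setP => j; rewrite !inE.
  - by [].
  - move=> j r lt_j _ good lt_r; apply: good_x => // ge_j.
    rewrite /sym_pos ltnNge ge_j /=; move: le1; move: (_ * (j - kR)) => q; lia.
  - rewrite filter_predT size_iota; have := bad_le1 predT.
    by move: nRE (\sum_(_ <- _ | _) _); lia.
  rewrite filter_predT in time_c res_g time_g; have [res_x time_x] := gray_x.
  apply: (bind_spec (T2 := TG + n * (26 * G)) (conj erefl time_c)); first by lia.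
  by rewrite res_g; split=> //; apply: leq_trans time_g _; lia.
have b_gt0 : 0 < b by lia.
apply: (@bind_spec _ _ _ _ (b <= lp + m * kR + (d + 1) * (m + d) - 1) _ (10 * G)
          (Cdec * n ^ 3 + TG + n * (16 * G))); [|by lia|].
  by rewrite /=; split=> //; op_bounds; lia.
(* Second case: the last [d + 1] parity symbols lie after [b]. At most [e + 1] errors face
   redundancy [d + 1], and [2 * e < d] gives exactly [2 * (e + 1) <= d + 1]. *)
case: (leqP b (lp + m * kR + (d + 1) * (m + d) - 1)) => [le2 | gt2].
  have [||||time_c [res_g time_g]] := @decode_and_index outer (outer_coords d n) x bad.
  - by [].
  - by move=> j lt_j; rewrite /outer lt_j.
  - move=> j r lt_j out_j good lt_r; apply: good_x => // ge_j.
    move: out_j; rewrite /outer ltnNge ge_j /= => ge_j'; rewrite /sym_pos ltnNge ge_j /=.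
    have : d + 1 <= j - kR by lia.
    move/(leq_mul (leqnn (m + d))); move: le2; rewrite [(d + 1) * _]mulnC.
    by move: (_ * (j - kR)) (_ * (d + 1)) => q q'; lia.
  - rewrite outerE size_cat !size_iota; have := bad_le1 outer.
    by move: nRE (\sum_(_ <- _ | _) _); lia.
  rewrite outerE map_cat -!nth_cbar in time_c res_g time_g; [|by move: nRE; lia..].
  have [res_x time_x] := gray_x.
  have [|||res_i time_i] := @copy_spec n n_gt0 _ (0%R : F) m cbar 0 kR [::]; try (rewrite /=; lia).
  apply: (bind_spec (T2 := Cdec * n ^ 3 + TG + n * (12 * G)) (conj res_i time_i)); first by lia.
  have [|||res_o time_o] := @copy_spec n n_gt0 _ (0%R : F) m cbar (kR + d + 1)
    (nR - (kR + d + 1)) ([::] ++ [seq nth 0%R cbar (0 + j) | j <- iota 0 kR]);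
    try by rewrite ?size_map ?size_iota; move: nRE; lia.
  have le_o := le_len _ (leq_subr (kR + d + 1) nR).
  apply: (bind_spec (T2 := Cdec * n ^ 3 + TG + n * (8 * G)) (conj res_o time_o)).
    by move: le_o; move: (_ * (4 * G)) => c; lia.
  apply: (bind_spec (T2 := TG + n * (8 * G)) (conj erefl time_c)); first by lia.
  by rewrite res_g; split=> //; apply: leq_trans time_g _; lia.
(* Third case: all kept symbols lie before [b], hence come from [x'] with no bad symbol; the decoded
   index is [a + 1]. *)
have [||||time_c [res_g time_g]] := @decode_and_index inner (inner_coords d n) x' pred0.
- by [].
- by move=> j lt_j; rewrite /inner; lia.
- move=> j r lt_j in_j _ lt_r; rewrite mixed_block_sym // ifT // /sym_pos.
  case: (ltnP j kR) => [lt_kR | ge_kR].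
    by have := leq_mul (leqnn m) lt_kR; rewrite mulnS; lia.
  have : j - kR <= d by move: in_j; rewrite /inner; lia.
  move/(leq_mul (leqnn (m + d))); move: gt2; rewrite [(d + 1) * _]mulnC addn1 mulnS.
  by move: (_ * (j - kR)) (_ * d) => q q'; lia.
- by rewrite innerE size_iota big1 //; lia.
rewrite innerE -!nth_cbar in time_c res_g time_g; last by move: nRE; lia.
have [res_x time_x] := gray_x' b_gt0.
have [|||res_i time_i] := @copy_spec n n_gt0 _ (0%R : F) m cbar 0 (kR + d + 1) [::];
  try (move: nRE; rewrite /=; lia).
have le_i : (kR + d + 1) * (4 * G) <= n * (4 * G) by apply: le_len; move: nRE; lia.
apply: (bind_spec (T2 := Cdec * n ^ 3 + TG + n * (12 * G)) (conj res_i time_i)); first by lia.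
apply: (bind_spec (T2 := TG + n * (12 * G)) (conj erefl time_c)); first by lia.
apply: (bind_spec (T2 := n * (4 * G)) (conj res_g time_g)); first by lia.
rewrite res_x /= subn1; split=> //; rewrite /linear_cost.
by have : bits 1 = 1 by []; lia.
Qed.

End FindBlock.

Section Locate.
Variable w : seq bool.
Hypothesis w_errors : \sum_(0 <= j < n) (nth false w j != V ((b + j) %% n)) <= e.

Let shift0 i : i < n -> ((i + b) %% n == 0) = (i == (n - b) %% n).
Proof.
move=> lt_i; have [b0 | b_gt0] := posnP b.
  by rewrite b0 addn0 subn0 modnn modn_small.
rewrite [(n - b) %% n]modn_small; last by lia.
have [lt_ib | ge_ib] := ltnP (i + b) n; first by rewrite modn_small //; lia.
have -> : i + b = i + b - n + n by lia.
by rewrite modnDr modn_small; lia.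
Qed.

Let mod_shift i j : (b + (i + j) %% n) %% n = ((i + b) %% n + j) %% n.
Proof. by rewrite modnDmr modnDml addnA [b + i]addnC. Qed.

Let window_errors i : i < n ->
  \sum_(0 <= j < lp) (nth false w ((i + j) %% n) != V (((i + b) %% n + j) %% n)) <= e.
Proof.
move=> lt_i; pose E j := nat_of_bool (nth false w j != V ((b + j) %% n)).
apply: leq_trans w_errors; rewrite -/E -(sum_rot E lt_i).
rewrite -[leqRHS](_ : \sum_(0 <= j < n) E ((i + (0 + j)) %% n) = _); last by [].
apply: leq_trans (@leq_sum_subrange (fun j => E ((i + j) %% n)) 0 lp n le_lp).
by apply: leq_sum => j _; rewrite /E mod_shift.
Qed.

(** At the true marker there are at most [e] mismatches; elsewhere the triangle inequality leaves at
    least [d - e], and 2(d - e) > d. *)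
Lemma unique_candidate : [seq i <- iota 0 n | is_candidate w i] = [:: (n - b) %% n].
Proof.
have lt_c : (n - b) %% n < n by rewrite ltn_mod.
rewrite (@eq_in_filter _ _ (pred1 ((n - b) %% n))).
  by rewrite filter_pred1_uniq ?iota_uniq // mem_iota.
move=> i; rewrite mem_iota => /andP[_ lt_i]; rewrite [RHS]/= -shift0 // /is_candidate.
have errs := window_errors lt_i; have [t0 | t_neq0] := eqVneq ((i + b) %% n) 0.
  suff : window_mismatch w i <= e by lia.
  apply: leq_trans errs; rewrite t0 /window_mismatch big_nat [leqRHS]big_nat.
  apply: leq_sum => j /= lt_j; rewrite add0n [j %% n]modn_small; last by lia.
  by rewrite /mixed_block nth_block_p.
have t_n : 0 < (i + b) %% n < n by rewrite lt0n t_neq0 ltn_mod.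
have far := mixed_block_marker_unique b xX xX' t_n.
suff : d <= e + window_mismatch w i by lia.
apply: leq_trans far _; apply: leq_trans (leq_add errs (leqnn _)).
rewrite -big_split; apply: leq_sum => j _ /=.
by case: (nth false w _) (V _) (nth false p _) => [] [] [].
Qed.

Let v := [seq nth false w (((n - b) %% n + j) %% n) | j <- iota 0 n].

Let v_errors : \sum_(0 <= i < n) (nth false v i != V i) <= e.
Proof.
have lt_c : (n - b) %% n < n by rewrite ltn_mod.
pose E j := nat_of_bool (nth false w j != V ((b + j) %% n)).
apply: leq_trans w_errors; rewrite -/E -(sum_rot E lt_c) big_nat [leqRHS]big_nat.
apply: leq_sum => i /= lt_i; rewrite (nth_map 0) ?size_iota // nth_iota // add0n /E mod_shift.
have /eqP -> : ((n - b) %% n + b) %% n == 0 by rewrite shift0.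
by rewrite add0n [i %% n]modn_small.
Qed.

(** Each [T2] below is the budget left after one more step; the decoders' share [T] is spent in
    [find_block]. *)
Lemma locate_spec :
  result (locate dec decG w) = Some (a * n + b) /\
  time (locate dec decG w) <= Cdec * n ^ 3 + TG + 100 * (n * (n * G)).
Proof.
have le_1G : G <= n * G by rewrite leq_pmull.
have le_nG1 : n * G <= n * (n * G) by rewrite leq_mul2l le_1G orbT.
have le_lpG : lp * (8 * G) <= n * (8 * G) by rewrite leq_mul2r le_lp orbT.
have cand_time : n * (lp * (8 * G) + 8 * G) <= 16 * (n * (n * G)).
  by rewrite [leqRHS]mulnCA leq_mul2l; apply/orP; right; lia.
have del_time : n * (n * (14 * G) + 3 * G) <= 17 * (n * (n * G)) by lia.
have read_time : nR * (m * (4 * G) + 6 * G) <= 10 * (n * G).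
  have := leq_mul le_mnR (leqnn (4 * G)); have := leq_mul le_nR (leqnn (6 * G)); lia.
have [res_c time_c] := candidates_spec w; rewrite unique_candidate in res_c.
have le_c : (n - b) %% n <= n by rewrite ltnW // ltn_mod.
have def_b : (n - (n - b) %% n) %% n = b.
  have [b0 | b_gt0] := posnP b; first by rewrite b0 subn0 modnn subn0 modnn.
  by rewrite [(n - b) %% n]modn_small ?subKn ?modn_small //; lia.
have [res_r time_r] := rotate_spec w le_c; rewrite -/v in res_r.
have [res_d time_d] := delete_markers_spec v.
have [res_s time_s] := read_symbols_spec
  [seq nth false v j | j <- iota 0 n & ~~ is_deleted j].
have def_s : [seq read_symbol [seq nth false v i | i <- iota 0 n & ~~ is_deleted i] (m * j)
              | j <- iota 0 nR] = [seq read_symbol v (sym_pos j) | j <- iota 0 nR].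
  by apply/eq_in_map => j; rewrite mem_iota => /andP[_ lt_j]; rewrite read_deleted.
rewrite def_s in res_s.
have find := find_block_spec v_errors.
have bits_an := bits_mul a n.
have le_ba : bits a <= n by apply: leq_trans bits_a; apply: leq_bits.
pose T := Cdec * n ^ 3 + TG.
apply: (bind_spec (T2 := T + 80 * (n * (n * G))) (conj res_c time_c)); first by lia.
apply: (@bind_spec _ _ _ _ tt _ 1 (T + 79 * (n * (n * G)))); [by [] | by lia |].
apply: (@bind_spec _ _ _ _ b _ (2 * G) (T + 77 * (n * (n * G)))); [|by lia|].
  rewrite /=; split=> //; move: ((n - b) %% n) le_c => c le_c; op_bounds; lia.
apply: (bind_spec (T2 := T + 72 * (n * (n * G))) (conj res_r time_r)); first by lia.
apply: (bind_spec (T2 := T + 55 * (n * (n * G))) (conj res_d time_d)); first by lia.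
apply: (bind_spec (T2 := T + 45 * (n * (n * G))) (conj res_s time_s)); first by lia.
apply: (bind_spec (T2 := 15 * (n * (n * G))) find); first by lia.
have bits_n : bits n + n <= G by apply: bits_le; lia.
have bits_b : bits b + n <= G by apply: bits_le; lia.
(* The index [a] can be exponential in [n], so its product with [n] is no unit operation; only its
   bit length is at most [n]. *)
have : bits a * bits n <= n * G by apply: leq_mul; lia.
by split=> //; rewrite /= /linear_cost /product_cost; lia.
Qed.

End Locate.

End Locating.

(** * Windows of the sequence *)

Lemma size_S_word : size (S_word K) = Mpar K * n.
Proof. by rewrite (size_flatten_blocks size_block) gray_size. Qed.

Lemma nth_S_word x0 q r : q < Mpar K -> r < n ->
  nth false (S_word K) (q * n + r) = nth false (block (nth x0 (gray K) q)) r.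
Proof. by move=> lt_q lt_r; apply: (nth_flatten_blocks size_block); rewrite ?gray_size. Qed.

(** The symbol whose image is all ones has weight [m >= d], so [Xset] is not empty. *)
Lemma Mpar_gt0 : 0 < Mpar K.
Proof.
rewrite expn_gt0; apply/orP; left; apply/card_gt0P.
exists (phi_inv K [tuple of nseq m true]).
by rewrite inE phi_invK /hamming_weight count_nseq mul1n; lia.
Qed.

(** Ensures that Gray indices have at most [n] bits. *)
Lemma Mpar_le : Mpar K <= 2 ^ (m * kR).
Proof.
by rewrite expnM /Mpar leq_exp2r; [rewrite -(card_Fq K) max_card | lia].
Qed.

Section Position.
Variables (x0 : kR.-tuple F) (w : n.-tuple bool) (i : nat).
Hypothesis le_i : i <= Mpar K * n - n.

Let a := i %/ n.
Let b := i %% n.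
Let x := nth x0 (gray K) a.
(** For [b = 0] the window is the single block [a], possibly the last one, so [x'] must not refer to
    a next block. *)
Let x' := nth x0 (gray K) (if b == 0 then a else a.+1).

Let lt_b : b < n. Proof. by rewrite ltn_mod. Qed.

Let lt_next : (if b == 0 then a else a.+1) < Mpar K.
Proof.
have def_i := divn_eq i n; rewrite -/a -/b in def_i.
have M_gt0 := Mpar_gt0.
have le_M : i <= (Mpar K).-1 * n by rewrite -subn1 mulnBl mul1n.
have le_a : a <= (Mpar K).-1 by rewrite -(leq_pmul2r n_gt0); lia.
case: eqVneq => [b0 | b_neq0]; first by lia.
have : a < (Mpar K).-1 by rewrite -(ltn_pmul2r n_gt0); lia.
by lia.
Qed.

Let lt_a : a < Mpar K.
Proof. by apply: leq_trans lt_next; case: ifP; rewrite ltnS. Qed.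

Lemma subword_errors :
  hamming_dist w (subword (S_word K) i (i + n - 1)) =
  \sum_(0 <= j < n) (nth false w j != mixed_block x x' b ((b + j) %% n)).
Proof.
have def_i := divn_eq i n; rewrite -/a -/b in def_i.
have le_nM : n <= Mpar K * n by rewrite leq_pmull ?Mpar_gt0.
have -> : subword (S_word K) i (i + n - 1) = take n (drop i (S_word K)).
  by rewrite /subword; congr take; lia.
rewrite (hamming_distE false (N := n)) ?size_tuple //; last first.
  by rewrite size_takel // size_drop size_S_word; lia.
apply: eq_big_nat => j /andP[_ lt_j]; congr (nat_of_bool (_ != _)).
rewrite nth_take // nth_drop /mixed_block.
(* Before the wrap the bit is in block [a] at offset [b + j >= b]; after it, in block [a + 1] at
   offset [b + j - n < b]. *)
have [lt_bj | ge_bj] := ltnP (b + j) n.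
  rewrite modn_small // ltnNge leq_addr /= -nth_S_word //.
  by rewrite addnA -def_i.
have b_neq0 : b != 0 by lia.
have lt_a1 : a.+1 < Mpar K by move: lt_next; rewrite (negbTE b_neq0).
have -> : b + j = b + j - n + n by lia.
rewrite modnDr modn_small; last by lia.
rewrite ifT; last by lia.
rewrite /x' (negbTE b_neq0) -nth_S_word //; last by lia.
by congr nth; rewrite mulSn; lia.
Qed.

Lemma gray_neighbours_diff : \sum_(0 <= j < kR) (nth 0%R x j != nth 0%R x' j) <= 1.
Proof.
rewrite -(@hamming_distE _ _ kR) ?size_tuple // /x /x'; case: eqVneq => [_ | b_neq0].
  by rewrite (@hamming_distE _ 0%R kR) ?size_tuple // big1 // => j _; rewrite eqxx.
have lt_a1 : a.+1 < size (gray K) by rewrite gray_size; move: lt_next; rewrite (negbTE b_neq0).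
by have /(sortedP x0)/(_ a lt_a1)/eqP -> := gray_step K.
Qed.

Lemma locate_position (dec : RS_decoder K) (decG : Gray_decoder K) (Cdec CGray e : nat) :
    RS_decoder_spec Cdec dec -> Gray_decoder_spec CGray decG ->
    hamming_dist w (subword (S_word K) i (i + n - 1)) = e -> 2 * e < d ->
  result (locate dec decG w) = Some i /\
  time (locate dec decG w) <= (Cdec + CGray + 64 * 100) * n ^ 3.
Proof.
move=> decP grayP errs few.
have in_X q : q < Mpar K -> all (fun c => c \in Xset K) (nth x0 (gray K) q).
  by move=> lt_q; rewrite -gray_mem mem_nth // gray_size.
have bits_a : bits a.+1 <= n.
  have : bits a.+1 <= (m * kR).+1; last by lia.
  rewrite ltnS -(@leq_exp2l 2) //; apply: leq_trans (trunc_logP _ _) _ => //.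
  exact: leq_trans lt_a Mpar_le.
have gray_x' : 0 < b ->
    result (decG x') = a.+1 /\ time (decG x') <= CGray * (kR * m ^ 2).
  move=> b_gt0; have := grayP (if b == 0 then a else a.+1) x0 lt_next.
  by rewrite -/x' (gtn_eqF b_gt0).
rewrite subword_errors in errs.
have [] := locate_spec decP few (in_X _ lt_a) (in_X _ lt_next) gray_neighbours_diff lt_b
  (grayP a x0 lt_a) gray_x' bits_a (eq_leq errs).
rewrite -divn_eq => -> le_T; split=> //; apply: leq_trans le_T _.
(* Both [m * kR] and [m] are at most [n]. *)
have le_gray : kR * m ^ 2 <= n ^ 3.
  have -> : kR * m ^ 2 = m * kR * m by rewrite !expnS expn0; lia.
  have -> : n ^ 3 = n * n * n by rewrite !expnS expn0; lia.
  apply: (@leq_trans (n * n)); last by rewrite leq_pmulr.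
  by apply: leq_mul; lia.
have := leq_mul (leqnn CGray) le_gray.
have -> : 100 * (n * (n * G)) = 64 * 100 * n ^ 3 by rewrite /op_cost !expnS expn0; lia.
move: (n ^ 3) => n3; lia.
Qed.

End Position.

End Code.

(** * Asymptotics of the parameters *)

(** With t = (m - 1) / 3 rounded down, (t + 1)^2 <= 4^t < n and m <= 3(t + 1). Either 3A <= t + 1,
    and A m <= (t + 1)^2, or A m <= 9 A^2. *)
Lemma m_par_small A : exists N, forall n, N <= n -> A * m_par n <= n.
Proof.
exists (9 * A * A).+2 => n le_n; set m := m_par n.
have m_lt : 4 ^ m.-1 < n ^ 3.
  have n3_gt1 : 1 < n ^ 3 by rewrite -(exp1n 3) ltn_exp2r //; lia.
  exact: up_log_gtn.
pose t := m.-1 %/ 3.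
have lt_n : 4 ^ t < n.
  rewrite -(@ltn_exp2r _ _ 3) // -expnM; apply: leq_ltn_trans m_lt.
  by rewrite leq_exp2l // leq_trunc_div.
have le_m : m <= 3 * t.+1 by have := divn_eq m.-1 3; have := ltn_pmod m.-1 (isT : 0 < 3); lia.
have sqr_t : t.+1 * t.+1 <= 4 ^ t by rewrite -[4]/(2 * 2) expnMn leq_mul // ltn_expl.
have : A * m <= A * (3 * t.+1) by rewrite leq_mul2l le_m orbT.
have [le_A | gt_A] := leqP (3 * A) t.+1.
  by have := leq_mul le_A (leqnn t.+1); lia.
by have := leq_mul (leqnn (3 * A)) gt_A; lia.
Qed.

Lemma large_params_eventually d : 0 < d ->
  exists N, forall n, N <= n -> integral_params d n -> large_params d n.
Proof.
(* The summands make room for the marker, of length at most [4 * m], for the ones before the parity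
   symbols, and for [2 * d + 4] symbols, so that [kR >= 2]. *)
move=> d_gt0; have [N smallP] := m_par_small (4 + (2 * d + 2) * d + (2 * d + 4)).
(* From 4^(ell d) <= n <= n^3 <= 4^m follows [ell d <= m]. *)
exists (maxn N (4 ^ ell d)) => n; rewrite geq_max => /andP[/smallP small le_n] integral.
have n_gt0 : 0 < n by apply: leq_trans le_n; rewrite expn_gt0.
have le_ell : ell d <= m_par n.
  rewrite -(@leq_exp2l 4) //; apply: leq_trans le_n _.
  by apply: leq_trans (up_logP (n ^ 3) (isT : 1 < 4)); rewrite -{1}(expn1 n) leq_pexp2l.
have d_ell : 2 * d <= ell d by rewrite /ell; lia.
have lpE : ell_p d n = 3 * m_par n + ell d by [].
have := divnK integral; rewrite -/(n_R d n) /n' => nRE.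
have m_gt0 : 0 < m_par n by lia.
have le_dm : (2 * d + 2) * d <= (2 * d + 2) * d * m_par n by rewrite leq_pmulr.
have nR_ge : 2 * d + 4 <= n_R d n by rewrite -(leq_pmul2r m_gt0) nRE; lia.
have kRE : k_R d n = n_R d n - 2 * d - 2 by [].
have defn : n = ell_p d n + (2 * d + 2) * d + n_R d n * m_par n by rewrite nRE; lia.
have nR_kR : n_R d n = k_R d n + 2 * d + 2 by lia.
split=> //; first by lia.
by rewrite {1}defn nR_kR; lia.
Qed.

Theorem theorem3p13 (d : nat) (hd : 1 <= d) :
  exists N : nat, forall Cdec CGray : nat, exists C : nat,
  forall n : nat, N <= n -> integral_params d n ->
  forall (K : construction1A d n) (dec : RS_decoder K) (decG : Gray_decoder K),
    RS_decoder_spec Cdec dec -> Gray_decoder_spec CGray decG ->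
  forall (w : n.-tuple bool) (i e : nat),
    i <= Mpar K * n - n ->
    hamming_dist w (subword (S_word K) i (i + n - 1)) = e ->
    2 * e < d ->
    result (locate dec decG w) = Some i /\ time (locate dec decG w) <= C * n ^ 3.
Proof.
have [N largeP] := large_params_eventually hd.
exists N => Cdec CGray; exists (Cdec + CGray + 64 * 100) => n /largeP large /large{}large.
move=> K dec decG decP grayP w i e le_i errs few.
(* The zero tuple is only a default for [nth]; all Gray indices read are in range. *)
exact: (locate_position large [tuple 0%R | _ < k_R d n] le_i decP grayP errs few).
Qed.
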